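(* Let $n\geq2$, $d\geq1$, $\Omega\subset\mathbb{R}^n$ open and $f:\Omega\to\mathbb{R}^d$ continuous. If for some gauge function $\varphi$ there is a set $N\subset\Omega$ with $\mathcal{H}^\varphi(N)=0$ and $\mathcal{H}^n(f(N))>0$, then there is a Cantor set $K\subset\Omega$ such that $\mathcal{H}^\varphi(K)=0$ and $\mathcal{H}^n(f(K))>0$.
   Context: A Cantor set is a nonempty compact, perfect, totally disconnected set. A gauge function is a nondecreasing $h:[0,\infty]\to[0,\infty]$, positive on $(0,\infty]$ and right-continuous; $\mathcal{H}^h(A)=\lim_{\delta\to0}\inf\{\sum_j h(\operatorname{diam}C_j): A\subset\bigcup_jC_j,\ \operatorname{diam}C_j\leq\delta\}$, and $\mathcal{H}^n$ is the case $h(t)=t^n$ (in $\mathbb{R}^d$). *)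

(* Defs.v *)
From HB Require Import structures.
From mathcomp Require Import all_boot all_order all_algebra.
From mathcomp Require Import all_classical all_reals all_analysis.
Set Implicit Arguments. Unset Strict Implicit. Unset Printing Implicit Defensive.
Import Order.TTheory GRing.Theory Num.Theory.
Import numFieldNormedType.Exports.
Local Open Scope classical_set_scope.
Local Open Scope ring_scope.

Section Hausdorff.
Variable R : realType.

Definition edist (n : nat) (x y : 'rV[R]_n) : R :=
  Num.sqrt (\sum_(i < n) (x ord0 i - y ord0 i) ^+ 2).

(* Euclidean diameter (in [0, +oo]); diam set0 = 0. *)
Definition ediam (n : nat) (A : set 'rV[R]_n) : \bar R :=
  ereal_sup ([set ((edist x y)%:E) | x in A & y in A] `|` [set 0%E]).

Definition gauge (h : \bar R -> \bar R) : Prop :=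
  [/\ (forall t, (0 <= t)%E -> (0 <= h t)%E),
      (forall s t, (0 <= s)%E -> (s <= t)%E -> (h s <= h t)%E),
      (forall t, (0 < t)%E -> (0 < h t)%E) &
      (forall t : R, 0 <= t -> (fun s : R => h s%:E) @ t^'+ --> h t%:E)].

(* cost of a countable cover: empty members are ignored, so that
   "countable (finite or infinite) covers" are represented by sequences *)
Definition cover_cost (n : nat) (h : \bar R -> \bar R)
    (C : nat -> set 'rV[R]_n) : \bar R :=
  (\sum_(0 <= j <oo) (if pselect (C j = set0) then 0 else h (ediam (C j))))%E.

Definition hcontent (n : nat) (h : \bar R -> \bar R) (delta : R)
    (A : set 'rV[R]_n) : \bar R :=
  ereal_inf [set cover_cost h C | C in
    [set C : nat -> set 'rV[R]_n |
       A `<=` \bigcup_j C j /\ forall j, (ediam (C j) <= delta%:E)%E]].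

(* H^h = lim_{delta -> 0} H^h_delta = sup_{delta > 0} H^h_delta
   (H^h_delta is nonincreasing in delta) *)
Definition hausdorff (n : nat) (h : \bar R -> \bar R)
    (A : set 'rV[R]_n) : \bar R :=
  ereal_sup [set hcontent h delta A | delta in [set delta : R | 0 < delta]].

Definition powgauge (m : nat) (t : \bar R) : \bar R :=
  match t with
  | EFin r => (r ^+ m)%:E
  | +oo%E => +oo%E
  | -oo%E => 0%E
  end.

Definition cantor_set (n : nat) (K : set 'rV[R]_n) : Prop :=
  [/\ K !=set0, compact K, perfect_set K & totally_disconnected K].

End Hausdorff.

(* Main.v *)
(* Write M for the content obtained from covers by half-open dyadic cubes of
   side at most 1, a cube of side s costing s^n; M and H^n have the same null
   sets. Enlarging efficient covers of N (right continuity of phi) puts N into a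
   G_delta set with the same null gauge measure. Next, among the flats parallel
   to the axes whose intersection with N has an image that is not null, take one
   of least dimension: its sections by the hyperplanes x_i = r, r rational,
   contribute null images and can be removed, after which every compact subset
   is totally disconnected. Net contents are continuous along increasing
   sequences of arbitrary sets, so the remaining part of N can be cut down
   successively by compact pieces of the open sets defining the G_delta without
   its image losing content; the intersection of these pieces is compact and its
   image is not null. Finally, its points having a neighborhood with null image
   form a set with null image, and the others form a perfect set. *)

Require Import Defs.
From HB Require Import structures.
From mathcomp Require Import all_boot all_order all_algebra.
From mathcomp Require Import all_classical all_reals all_analysis.
From mathcomp Require Import ring lra.
Import Order.TTheory GRing.Theory Num.Theory.
Import numFieldNormedType.Exports.
Local Open Scope classical_set_scope.
Local Open Scope ring_scope.

Set Implicit Arguments.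
Unset Strict Implicit.
Unset Printing Implicit Defensive.

(** * Net contents *)

Section esum_extra.
Variables (R : realType) (T : choiceType) (a : T -> \bar R).
Hypothesis a0 : forall t, (0 <= a t)%E.

Lemma esum_subset (A B : set T) : A `<=` B ->
  (\esum_(t in A) a t <= \esum_(t in B) a t)%E.
Proof.
move=> AB; apply: ge_ereal_sup => _ [X [fX XA] <-].
by apply: ereal_sup_ubound; exists X => //; split => //; apply: subset_trans AB.
Qed.

(** Each index counts once for every one of the two sets containing it. The additive form avoids
    subtracting sums that may be infinite. *)
Lemma esumUI (A B : set T) :
  (\esum_(t in A `|` B) a t + \esum_(t in A `&` B) a t =
   \esum_(t in A) a t + \esum_(t in B) a t)%E.
Proof.
have pos (C : set T) t : [set: T] t -> (0 <= if t \in C then a t else 0)%E.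
  by move=> _; case: ifP.
rewrite (esum_mkcond (A `|` B)) (esum_mkcond (A `&` B)) (esum_mkcond A).
rewrite (esum_mkcond B) -!esumD; do ?exact: pos.
apply: eq_esum => t _; rewrite in_setU in_setI.
by case: (t \in A); case: (t \in B); rewrite /= ?adde0 ?add0e.
Qed.

Lemma esumU_le (A B : set T) :
  (\esum_(t in A `|` B) a t <= \esum_(t in A) a t + \esum_(t in B) a t)%E.
Proof. by rewrite -esumUI leeDl// esum_ge0. Qed.

End esum_extra.

Section net_content.
Variables (R : realType) (T : Type) (I : choiceType).
Variables (q : nat -> T -> I) (c : nat -> R).
Hypothesis c0 : forall j, 0 <= c j.
Hypothesis qS : forall i j x y, (i <= j)%N -> q j x = q j y -> q i x = q i y.

(** A pair [(j, v)] stands for the cell of all [x] with [q j x = v], of generation [j] and cost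
    [c j]; by [qS] the cells are nested. *)
Definition net_cost (W : set (nat * I)) : \bar R := \esum_(w in W) (c w.1)%:E.

Definition net_cover (W : set (nat * I)) (A : set T) :=
  forall x, A x -> exists j, W (j, q j x).

Definition net_content (A : set T) : \bar R :=
  ereal_inf [set net_cost W | W in [set W | net_cover W A]].

Lemma net_cost_ge0 W : (0 <= net_cost W)%E.
Proof. by apply: esum_ge0 => w _; rewrite lee_fin. Qed.

Lemma net_content_ge0 A : (0 <= net_content A)%E.
Proof. by apply: le_ereal_inf_tmp => _ [W _ <-]; exact: net_cost_ge0. Qed.

Lemma net_content_le_cost W A : net_cover W A ->
  (net_content A <= net_cost W)%E.
Proof. by move=> WA; apply: ereal_inf_lbound; exists W. Qed.

Lemma net_contentS A B : A `<=` B -> (net_content A <= net_content B)%E.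
Proof.
move=> AB; apply: le_ereal_inf_tmp => _ [W WB <-].
by apply: net_content_le_cost => x /AB/WB.
Qed.

Lemma net_content_lt A x : (net_content A < x)%E ->
  exists2 W, net_cover W A & (net_cost W < x)%E.
Proof. by move=> /ereal_inf_lt[_ [W WA <-]] Wx; exists W. Qed.

Lemma net_content_adherent A (e : R) : net_content A \is a fin_num -> 0 < e ->
  exists2 W, net_cover W A & (net_cost W <= net_content A + e%:E)%E.
Proof.
move=> fA e0; have /net_content_lt[W WA We] :
  (net_content A < net_content A + e%:E)%E by rewrite lteDl// lte_fin.
by exists W => //; apply: ltW.
Qed.

Lemma net_content_cell j v : (net_content [set x | q j x = v] <= (c j)%:E)%E.
Proof.
rewrite -(@esum_set1 R _ (j, v) (fun w => (c w.1)%:E)) ?lee_fin//.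
by apply: net_content_le_cost => x /= <-; exists j.
Qed.

Lemma net_contentU A B :
  (net_content (A `|` B) <= net_content A + net_content B)%E.
Proof.
have [fA|] := boolP (net_content A \is a fin_num); last first.
  rewrite ge0_fin_numE ?net_content_ge0// -leNgt leye_eq => /eqP ->.
  by rewrite addye ?leey// gt_eqF// (lt_le_trans _ (net_content_ge0 _)).
have [fB|] := boolP (net_content B \is a fin_num); last first.
  rewrite ge0_fin_numE ?net_content_ge0// -leNgt leye_eq => /eqP ->.
  by rewrite addey ?leey// gt_eqF// (lt_le_trans _ (net_content_ge0 _)).
apply/lee_addgt0Pr => e e0.
have e20 : 0 < e / 2 by rewrite divr_gt0.
have [W WA We] := net_content_adherent fA e20.
have [V VB Ve] := net_content_adherent fB e20.
apply: (@le_trans _ _ (net_cost (W `|` V))).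
  by apply: net_content_le_cost => x [/WA|/VB][j ?]; exists j; [left|right].
apply: (@le_trans _ _ (net_cost W + net_cost V)%E).
  by apply: esumU_le => w; rewrite lee_fin.
apply: le_trans (leeD We Ve) _.
rewrite [e in leRHS]splitr EFinD; lazymatch goal with |- is_true (?a <= ?b)%E =>
  suff -> : a = b by [] end.
by rewrite addeACA.
Qed.

Lemma net_content_sum (J : eqType) (s : seq J) (A : J -> set T) B :
  (forall x, B x -> exists2 j, j \in s & A j x) ->
  (net_content B <= \sum_(j <- s) net_content (A j))%E.
Proof.
elim: s B => [|j s IH] B sB.
  rewrite big_nil -(@esum_set0 R _ (fun w : nat * I => (c w.1)%:E)).
  by apply: net_content_le_cost => x /sB[? []].
rewrite big_cons.
apply: (@le_trans _ _ (net_content (A j `|` B `\` A j))).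
  by apply: net_contentS => x Bx; have [?|?] := pselect (A j x); [left|right].
apply: le_trans (net_contentU _ _) _; rewrite leeD2l//.
apply: IH => x [/sB[k]].
by rewrite inE => /predU1P[->//|ks] Akx _; exists k.
Qed.

(** The maximal cells of [W], labels of empty cells being dropped. A single point [x] suffices to
    test maximality, since by [qS] the points of a cell share all coarser cells. *)
Definition net_top (W : set (nat * I)) : set (nat * I) :=
  [set w | W w /\
    exists2 x, q w.1 x = w.2 & forall i, (i < w.1)%N -> ~ W (i, q i x)].

Lemma net_cover_top W A : net_cover W A -> net_cover (net_top W) A.
Proof.
move=> WA x /WA[j Wj].
have exW : exists i, `[< W (i, q i x) >] by exists j; apply/asboolP.
case: (ex_minnP exW) => i /asboolP Wi imin; exists i; split => //=.
exists x => // k ki Wk.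
by have := imin k; rewrite leqNgt ki; move/(_ (asboolT Wk)).
Qed.

Lemma net_top_le W x i j : net_top W (i, q i x) -> W (j, q j x) -> (i <= j)%N.
Proof.
move=> [_ [/= y yx ymin]] Wj; rewrite leqNgt; apply/negP => ji.
by apply: (ymin _ ji); rewrite (qS (ltnW ji) yx).
Qed.

(* Discarding from W u V the cells contained in larger ones leaves enough cells
   to cover a second time what W and V both cover: the strong subadditivity of
   net contents. *)
Lemma net_cost_topU W V A : net_cover W A -> net_cover V A ->
  (net_cost (net_top (W `|` V)) + net_content A <= net_cost W + net_cost V)%E.
Proof.
move=> WA VA; have pos (w : nat * I) : (0 <= (c w.1)%:E)%E by rewrite lee_fin.
pose rest := (W `|` V) `&` ~` net_top (W `|` V).
rewrite /net_cost -(esumUI pos) (esumID (net_top (W `|` V)) (W `|` V))//.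
rewrite (_ : (W `|` V) `&` net_top (W `|` V) = net_top (W `|` V)); last first.
  by apply/seteqP; split => [w []//|w /[dup] -[]].
rewrite -addeA leeD2l//.
apply: le_trans (@esumU_le R _ _ pos rest (W `&` V)).
apply: net_content_le_cost => x Ax.
have [i Wi] := WA _ Ax; have [j Vj] := VA _ Ax.
case: (ltngtP i j) => [ij|ji|ij]; last by exists i; right; split => //; rewrite ij.
  exists j; left; split; first by right.
  by move=> /net_top_le/(_ (or_introl Wi)); rewrite leqNgt ij.
exists i; left; split; first by left.
by move=> /net_top_le/(_ (or_intror Vj)); rewrite leqNgt ji.
Qed.

(** Near-optimal covers [U k] are merged one by one, keeping maximal cells only. By strong
    subadditivity each merge costs at most the increase in content plus a small error, so the costs
    telescope. Around a fixed point the cells can only grow, hence stabilize, and the cells that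
    stay forever cover the union. *)
Lemma net_content_bigcup (E : nat -> set T) (r : R) :
  (forall i j, (i <= j)%N -> E i `<=` E j) ->
  (forall k, net_content (E k) <= r%:E)%E ->
  (net_content (\bigcup_k E k) <= r%:E)%E.
Proof.
move=> Einc Er; apply/lee_addgt0Pr => e e0.
have Efin k : net_content (E k) \is a fin_num.
  by rewrite ge0_fin_numE ?net_content_ge0// (le_lt_trans (Er k))// ltry.
pose m k := fine (net_content (E k)).
have mE k : net_content (E k) = (m k)%:E by rewrite fineK.
have /choice[U UP] : forall k, exists U, net_cover U (E k) /\
    (net_cost U <= (m k + e / 2 ^+ k.+1)%:E)%E.
  move=> k; have ek : 0 < e / 2 ^+ k.+1 by rewrite divr_gt0// exprn_gt0.
  by have [U ? ?] := net_content_adherent (Efin k) ek; exists U; rewrite EFinD -mE.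
pose W := fix W k := if k is k'.+1 then net_top (W k' `|` U k'.+1) else U 0%N.
have WE k : net_cover (W k) (E k).
  case: k => [|k]; first exact: (UP 0%N).1.
  by apply: net_cover_top => x /(UP k.+1).1[j Uj]; exists j; right.
(* The factor [1 - 2 ^- k.+1] is the sum of the errors [2 ^- j.+1] for [j <= k]. *)
have Wcost k : (net_cost (W k) <= (m k + e * (1 - 2 ^- k.+1))%:E)%E.
  elim: k => [|k IH].
    apply: le_trans (UP 0%N).2 _; rewrite lee_fin lerD2l ler_pM2l// !expr1.
    by lra.
  have UE : net_cover (U k.+1) (E k).
    by move=> x Ekx; apply: (UP k.+1).1; apply: Einc Ekx; exact: leqnSn.
  have := net_cost_topU (WE k) UE.
  rewrite mE => /le_trans/(_ (leeD IH (UP k.+1).2)).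
  rewrite -EFinD -[net_top _]/(W k.+1) => H.
  have fW : net_cost (W k.+1) \is a fin_num.
    rewrite ge0_fin_numE ?net_cost_ge0//.
    by move: H; case: (net_cost _) (net_cost_ge0 (W k.+1)) => //= s _ _; rewrite ltry.
  move: H; rewrite -(fineK fW) -EFinD !lee_fin.
  have -> : (2 : R) ^- k.+1 = 2 * 2 ^- k.+2.
    by rewrite [in RHS]exprS invfM mulrA divff ?mul1r// pnatr_eq0.
  lra.
(* The cells present from some stage on. Finitely many of them lie in a common [W K], so the bound
   on the costs passes to [Winf]. *)
pose Winf := [set w | exists k, forall k', (k <= k')%N -> W k' w].
apply: (@le_trans _ _ (net_cost Winf)); last first.
  apply: ge_ereal_sup => _ [X [fX XW] <-].
  have [K KP] : exists K, X `<=` W K.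
    have /choice[g gP] : forall w, exists k, X w ->
        forall k', (k <= k')%N -> W k' w.
      move=> w; have [/XW[k kP]|nX] := pselect (X w); first by exists k.
      by exists 0%N.
    have /finite_seqP[s sX] := fX.
    exists (\max_(w <- s) g w) => w Xw; apply: gP => //.
    by apply: leq_bigmax_seq => //; move: Xw; rewrite sX.
  apply: (@le_trans _ _ (net_cost (W K))).
    by apply: ereal_sup_ubound; exists X.
  apply: le_trans (Wcost K) _; rewrite -EFinD lee_fin lerD//.
    by rewrite -lee_fin -mE.
  by rewrite ler_piMr ?ltW// gerBl invr_ge0 exprn_ge0.
apply: net_content_le_cost => x [k0 _ Ex].
(* The least generation [g] of a cell around [x] met from stage [k0] on: no later cell around [x] is
   larger, so maximality keeps this one in every later cover. *)
have exg : exists g, `[< exists2 k, (k0 <= k)%N & W k (g, q g x) >].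
  by have [g Wg] := WE _ _ Ex; exists g; apply/asboolP; exists k0.
case: (ex_minnP exg) => g /asboolP[k1 k01 Wg] gmin; exists g, k1.
elim=> [|k IH]; first by rewrite leqn0 => /eqP k1E; rewrite -k1E.
rewrite leq_eqVlt => /predU1P[<-//|]; rewrite ltnS => k1k.
have k0k : (k0 <= k)%N := leq_trans k01 k1k.
have [i Wi] := WE k.+1 _ (Einc _ _ (leq_trans k0k (leqnSn k)) _ Ex).
suff -> : g = i by [].
apply/eqP; rewrite eqn_leq; apply/andP; split.
  by apply: gmin; apply/asboolP; exists k.+1 => //; apply: leqW.
by apply: (net_top_le Wi); left; apply: IH.
Qed.

(** The finite partial unions increase to the whole union, so continuity along increasing sequences
    upgrades finite subadditivity to countable subadditivity. *)
Lemma net_content_sigma (A : nat -> set T) (e : nat -> R) (r : R) :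
  (forall k, net_content (A k) <= (e k)%:E)%E ->
  (forall k, \sum_(j < k) e j <= r) ->
  (net_content (\bigcup_k A k) <= r%:E)%E.
Proof.
move=> Ae er.
rewrite (_ : \bigcup_k A k = \bigcup_k \bigcup_(j in `I_k) A j); last first.
  apply/seteqP; split => [x [k _ Ax]|x [k _ [j _ Ax]]]; last by exists j.
  by exists k.+1 => //; exists k => //=.
apply: net_content_bigcup => [i j ij x [k /= ki Akx]|k].
  by exists k => //=; apply: leq_trans ij.
apply: (@le_trans _ _ (\sum_(j < k) (e j)%:E)%E); last by rewrite sumEFin lee_fin.
rewrite -(big_mkord xpredT (fun j => (e j)%:E)).
apply: (@le_trans _ _ (\sum_(0 <= j < k) net_content (A j))%E); last exact: lee_sum.
apply: net_content_sum => x [j /= jk Ajx]; exists j => //.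
by rewrite mem_index_iota.
Qed.

End net_content.

(** * Euclidean distance, diameters and gauge costs *)

Section euclidean_diameter.
Variables (R : realType) (n : nat).
Implicit Types (x y z u v : 'rV[R]_n) (A : set 'rV[R]_n).

(** Cauchy-Schwarz: expand the nonnegative sum of the [(b * u i - a * v i) ^+ 2], where [a] and [b]
    are the norms of [u] and [v]. *)
Lemma sum_mul_le_sqrt (u v : 'I_n -> R) :
  \sum_i u i * v i <= Num.sqrt (\sum_i u i ^+ 2) * Num.sqrt (\sum_i v i ^+ 2).
Proof.
have pos (w : 'I_n -> R) : 0 <= \sum_i w i ^+ 2.
  by apply: sumr_ge0 => i _; exact: sqr_ge0.
have zero (w w' : 'I_n -> R) : \sum_i w i ^+ 2 = 0 -> \sum_i w i * w' i = 0.
  move=> /eqP; rewrite psumr_eq0 => [/allP w0|i _]; last exact: sqr_ge0.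
  apply: big1 => i _; have := w0 i; rewrite mem_index_enum => /(_ isT) /=.
  by rewrite sqrf_eq0 => /eqP ->; rewrite mul0r.
set U := \sum_i u i ^+ 2; set V := \sum_i v i ^+ 2.
set a := Num.sqrt U; set b := Num.sqrt V.
have [U0|U0] := eqVneq U 0; first by rewrite zero// mulr_ge0// sqrtr_ge0.
have [V0|V0] := eqVneq V 0.
  under eq_bigr do rewrite mulrC.
  by rewrite zero// mulr_ge0// sqrtr_ge0.
have a0 : 0 < a by rewrite sqrtr_gt0 lt_neqAle eq_sym U0 pos.
have b0 : 0 < b by rewrite sqrtr_gt0 lt_neqAle eq_sym V0 pos.
have : 0 <= \sum_i (b * u i - a * v i) ^+ 2 by apply: pos.
have -> : \sum_i (b * u i - a * v i) ^+ 2 =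
    b ^+ 2 * U - (2 * a * b) * (\sum_i u i * v i) + a ^+ 2 * V.
  rewrite /U /V !mulr_sumr -sumrB -big_split /=.
  by apply: eq_bigr => i _; ring.
have <- : a ^+ 2 = U by rewrite /a sqr_sqrtr ?pos.
have <- : b ^+ 2 = V by rewrite /b sqr_sqrtr ?pos.
have -> : b ^+ 2 * a ^+ 2 - 2 * a * b * (\sum_i u i * v i) + a ^+ 2 * b ^+ 2 =
  (2 * a * b) * (a * b - \sum_i u i * v i) by ring.
by rewrite pmulr_rge0 ?subr_ge0// !mulr_gt0.
Qed.

Lemma edist_ge0 x y : 0 <= Defs.edist x y.
Proof. exact: sqrtr_ge0. Qed.

Lemma edist_triangle x y z :
  Defs.edist x z <= Defs.edist x y + Defs.edist y z.
Proof.
rewrite -(@ler_pXn2r _ 2)// ?nnegrE ?addr_ge0 ?edist_ge0//.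
have pos (w : 'I_n -> R) : 0 <= \sum_i w i ^+ 2.
  by apply: sumr_ge0 => i _; exact: sqr_ge0.
rewrite sqrrD /Defs.edist !sqr_sqrtr//.
pose u i := x ord0 i - y ord0 i; pose v i := y ord0 i - z ord0 i.
have := sum_mul_le_sqrt u v; rewrite -(ler_pMn2r (n := 2))// => uv.
apply: (@le_trans _ _ (\sum_i u i ^+ 2 + (\sum_i u i * v i) *+ 2 +
    \sum_i v i ^+ 2)); last by rewrite lerD2r lerD2l.
rewrite -sumrMnl -!big_split /= le_eqVlt; apply/orP; left; apply/eqP.
by apply: eq_bigr => i _; rewrite /u /v -sqrrD; congr (_ ^+ 2); ring.
Qed.

Lemma coord_le_edist x y i : `|x ord0 i - y ord0 i| <= Defs.edist x y.
Proof.
rewrite /Defs.edist -sqrtr_sqr ler_wsqrtr// (bigD1 i)//= lerDl.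
by apply: sumr_ge0 => j _; exact: sqr_ge0.
Qed.

Lemma edist_le x y r : 0 <= r -> (forall i, `|x ord0 i - y ord0 i| <= r) ->
  Defs.edist x y <= Num.sqrt n%:R * r.
Proof.
move=> r0 xyr; rewrite -[in leRHS](ger0_norm r0) /Defs.edist -sqrtr_sqr -sqrtrM//.
rewrite ler_wsqrtr//.
rewrite mulr_natl -[n in leRHS]card_ord -sumr_const; apply: ler_sum => i _.
by rewrite -real_normK ?num_real// lerXn2r// nnegrE.
Qed.

Lemma ediam_ge0 A : (0 <= ediam A)%E.
Proof. by apply: ereal_sup_ubound; right. Qed.

Lemma edist_le_ediam A x y : A x -> A y -> ((Defs.edist x y)%:E <= ediam A)%E.
Proof. by move=> Ax Ay; apply: ereal_sup_ubound; left; exists x => //; exists y. Qed.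

Lemma ediam_le A (r : R) : 0 <= r ->
  (forall x y, A x -> A y -> Defs.edist x y <= r) -> (ediam A <= r%:E)%E.
Proof.
move=> r0 Ar; apply: ge_ereal_sup => _ [[x Ax [y Ay <-]]|->]; rewrite lee_fin//.
exact: Ar.
Qed.

Lemma ediamS A B : A `<=` B -> (ediam A <= ediam B)%E.
Proof.
move=> AB; apply: ge_ereal_sup => _ [[x /AB Bx [y /AB By <-]]|->].
  exact: edist_le_ediam.
exact: ediam_ge0.
Qed.

(* [cover_cost h C] unfolds to the sum of the [gauge_cost h (C j)]. *)
Definition gauge_cost (h : \bar R -> \bar R) A : \bar R :=
  (if pselect (A = set0) then 0 else h (ediam A))%E.

Lemma gauge_cost0 h : gauge_cost h set0 = 0%E.
Proof. by rewrite /gauge_cost; case: (pselect (set0 = set0)). Qed.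

Lemma gauge_costE h A : A !=set0 -> gauge_cost h A = h (ediam A).
Proof. by move=> /set0P/eqP A0; rewrite /gauge_cost; case: (pselect (A = set0)). Qed.

Lemma gauge_cost_ge0 h A : (forall t, 0 <= t -> 0 <= h t)%E ->
  (0 <= gauge_cost h A)%E.
Proof.
move=> h0; have [->|/set0P A0] := eqVneq A set0; first by rewrite gauge_cost0.
by rewrite gauge_costE//; exact/h0/ediam_ge0.
Qed.

Lemma hcontent_ge0 h delta A : (forall t, 0 <= t -> 0 <= h t)%E ->
  (0 <= hcontent h delta A)%E.
Proof.
move=> h0; apply: le_ereal_inf_tmp => _ [C _ <-]; apply: nneseries_ge0 => j _ _.
exact: gauge_cost_ge0.
Qed.

Lemma hausdorff_ge0 h A : (forall t, 0 <= t -> 0 <= h t)%E ->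
  (0 <= hausdorff h A)%E.
Proof.
move=> h0; apply: le_trans (hcontent_ge0 1 A h0) _.
by apply: ereal_sup_ubound; exists 1 => //=.
Qed.

Lemma hcontent_le_hausdorff h A delta : 0 < delta ->
  (hcontent h delta A <= hausdorff h A)%E.
Proof. by move=> delta0; apply: ereal_sup_ubound; exists delta. Qed.

Lemma hausdorffS h A B : A `<=` B -> (hausdorff h A <= hausdorff h B)%E.
Proof.
move=> AB; apply: ge_ereal_sup => _ [delta delta0 <-].
apply: le_trans (hcontent_le_hausdorff h B delta0).
apply: le_ereal_inf_tmp => _ [C [BC Cdelta] <-]; apply: ereal_inf_lbound.
by exists C => //; split => //; apply: subset_trans BC.
Qed.

End euclidean_diameter.

(** * Dyadic content and Hausdorff measure *)

Section dyadic.
Variables (R : realType) (d : nat).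
Implicit Types (x y : 'rV[R]_d) (A : set 'rV[R]_d).

Definition dyadic_index (j : nat) x : {ffun 'I_d -> int} :=
  [ffun i => Num.floor (2 ^+ j * x ord0 i)].

(** For an integer [m], the inequality [m <= 2 ^+ i * x] amounts to
    [2 ^+ (j - i) * m <= 2 ^+ j * x], which the floor at scale [j] decides. *)
Lemma dyadic_indexS i j x y : (i <= j)%N ->
  dyadic_index j x = dyadic_index j y -> dyadic_index i x = dyadic_index i y.
Proof.
move=> ij exy; apply/ffunP => k; rewrite !ffunE.
have := congr1 (fun f : {ffun 'I_d -> int} => f k) exy; rewrite !ffunE.
move: (x ord0 k) (y ord0 k) => {exy}x {}y exy.
wlog suff le : x y exy / Num.floor (2 ^+ i * x) <= Num.floor (2 ^+ i * y).
  by apply/eqP; rewrite eq_le !le.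
have p0 : (0 : R) < 2 ^+ (j - i) by rewrite exprn_gt0.
have e z : 2 ^+ j * z = 2 ^+ (j - i) * (2 ^+ i * z) :> R.
  by rewrite mulrA -exprD subnK.
rewrite floor_ge_int -(ler_pM2l p0) -e -[2]/(2%:~R) -rmorphXn -rmorphM.
rewrite -floor_ge_int -exy floor_ge_int rmorphM rmorphXn /= e ler_pM2l//.
exact: floor_le.
Qed.

Lemma dyadic_index_dist j x y : dyadic_index j x = dyadic_index j y ->
  forall i, `|x ord0 i - y ord0 i| <= 2 ^- j.
Proof.
move=> exy i; have := congr1 (fun f : {ffun 'I_d -> int} => f i) exy.
rewrite !ffunE; move: (x ord0 i) (y ord0 i) => {exy}x {}y exy.
have p0 : (0 : R) < 2 ^+ j by rewrite exprn_gt0.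
rewrite -(ler_pM2l p0) divff ?gt_eqF// -[X in X * `|_|]gtr0_norm// -normrM mulrBr.
have := floor_itv (2 ^+ j * x); have := floor_itv (2 ^+ j * y); rewrite exy.
rewrite intrD => /andP[a1 a2] /andP[b1 b2]; rewrite ler_norml.
by apply/andP; split; lra.
Qed.

(** The shift [s i - 1] takes the values -1, 0 and 1, so [s] runs over the cube of [x] and the cubes
    touching it. *)
Definition dyadic_neighbor (j : nat) x (s : {ffun 'I_d -> 'I_3}) :
  {ffun 'I_d -> int} := [ffun i => dyadic_index j x i + (s i)%:Z - 1].

Lemma dyadic_neighborP j x y : (forall i, `|x ord0 i - y ord0 i| < 2 ^- j) ->
  exists s, dyadic_index j y = dyadic_neighbor j x s.
Proof.
move=> xy; suff /choice[s sP] : forall i, exists s : 'I_3,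
    dyadic_index j y i = dyadic_index j x i + s%:Z - 1.
  by exists [ffun i => s i]; apply/ffunP => i; rewrite sP !ffunE.
move=> i; move: (xy i); rewrite !ffunE; move: (x ord0 i) (y ord0 i) => {xy}x {}y.
have p0 : (0 : R) < 2 ^+ j by rewrite exprn_gt0.
rewrite -(ltr_pM2l p0) divff ?gt_eqF// -[X in X * `|_|]gtr0_norm// -normrM mulrBr.
have := floor_itv (2 ^+ j * x); have := floor_itv (2 ^+ j * y).
move: (Num.floor _) (Num.floor _) => a b.
rewrite !intrD => /andP[a1 a2] /andP[b1 b2]; rewrite ltr_norml => /andP[c1 c2].
have ab : b - 1 <= a by rewrite -ltzD1 -(ltr_int R) !(intrD, rmorphN) /=; lra.
have ba : a <= b + 1 by rewrite -ltzD1 -(ltr_int R) !(intrD, rmorphN) /=; lra.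
have s3 : (absz (b - a + 1)%R < 3)%N.
  by rewrite -ltz_nat gez0_abs; lra.
by exists (Ordinal s3); rewrite /= gez0_abs; [ring|lra].
Qed.

Variable n : nat.

Definition dyadic_cost (j : nat) : R := (2 ^- j) ^+ n.

Lemma dyadic_cost_ge0 j : 0 <= dyadic_cost j.
Proof. by rewrite /dyadic_cost exprn_ge0// invr_ge0 exprn_ge0. Qed.

Definition dyadic_content A : \bar R := net_content dyadic_index dyadic_cost A.

Lemma powgauge_le (t : \bar R) (r : R) : (0 <= t)%E -> (t <= r%:E)%E ->
  (powgauge n t <= (r ^+ n)%:E)%E.
Proof.
case: t => [t| |]//=; rewrite !lee_fin => t0 tr.
by rewrite lerXn2r// nnegrE// (le_trans t0).
Qed.

Lemma powgauge_ge0 (t : \bar R) : (0 <= t)%E -> (0 <= powgauge n t)%E.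
Proof. by case: t => [t| |]//=; rewrite !lee_fin => t0; exact: exprn_ge0. Qed.

Lemma ediam_dyadic_cell j v :
  (ediam [set x | dyadic_index j x = v] <= (Num.sqrt d%:R * 2 ^- j)%:E)%E.
Proof.
apply: ediam_le => [|x y /= <- exy].
  by rewrite mulr_ge0 ?sqrtr_ge0// invr_ge0 exprn_ge0.
apply: edist_le; first by rewrite invr_ge0 exprn_ge0.
exact: dyadic_index_dist.
Qed.

(** In a cover of small total cost every single cube has small cost, hence, [n] being positive,
    small side: the bound on the diameters comes for free. *)
Lemma hausdorff0_dyadic_content0 A : (0 < n)%N -> dyadic_content A = 0%E ->
  hausdorff (@powgauge R n) A = 0%E.
Proof.
move=> n0 A0; apply/eqP; rewrite eq_le hausdorff_ge0 ?andbT; last first.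
  exact: powgauge_ge0.
apply: ge_ereal_sup => _ [delta /= delta0 <-]; apply/lee_addgt0Pr => e e0.
(* The summand 1 keeps [s] positive when [d = 0]. *)
rewrite add0e; pose s : R := Num.sqrt d%:R + 1.
have s0 : 0 < s by rewrite ltr_wpDl ?sqrtr_ge0.
(* The first bound makes the total cost at most [e], the second makes all diameters at most
   [delta]. *)
pose eta := Num.min (e / s ^+ n) ((delta / s) ^+ n).
have eta0 : 0 < eta by rewrite lt_min divr_gt0 ?exprn_gt0// divr_gt0.
have := @net_content_lt _ _ _ dyadic_index dyadic_cost A eta%:E.
rewrite -/(dyadic_content A) A0 lte_fin => /(_ eta0)[W WA Weta].
have small w : W w -> s * 2 ^- w.1 <= delta.
  move=> Ww; rewrite mulrC -ler_pdivlMr//.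
  rewrite -(@ler_pXn2r _ n)// ?nnegrE ?invr_ge0 ?exprn_ge0//; last first.
    by rewrite divr_ge0// ltW.
  rewrite -lee_fin; apply: (@le_trans _ _ eta%:E); last first.
    by rewrite lee_fin ge_min lexx orbT.
  apply: le_trans (ltW Weta).
  rewrite -[leLHS](@esum_set1 R _ w (fun w => (dyadic_cost w.1)%:E)) ?lee_fin//.
    by apply: esum_subset => t ->.
  exact: dyadic_cost_ge0.
(* The cells of [W] as a sequence indexed by their codes; a number coding no cell of [W] gives the
   empty set, which costs nothing. *)
pose C k := [set x | exists2 w : nat * {ffun 'I_d -> int},
  W w /\ pickle w = k & dyadic_index w.1 x = w.2].
have CE w : W w -> C (pickle w) `<=` [set x | dyadic_index w.1 x = w.2].
  by move=> Ww x [w' [_ /(pcan_inj pickleK_inv) ->]].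
have Cdiam w : W w -> (ediam (C (pickle w)) <= (s * 2 ^- w.1)%:E)%E.
  move=> Ww; apply: le_trans (ediamS (CE _ Ww)) _.
  apply: le_trans (ediam_dyadic_cell _ _) _.
  by rewrite lee_fin ler_wpM2r ?invr_ge0 ?exprn_ge0// lerDl.
have Cempty k : ~ (exists2 w, W w & pickle w = k) -> C k = set0.
  move=> nk; rewrite -subset0 => x [w [Ww wk] _].
  by apply: nk; exists w.
apply: (@le_trans _ _ (cover_cost (@powgauge R n) C)).
  apply: ereal_inf_lbound; exists C => //; split.
    move=> x /WA[j Wj]; exists (pickle (j, dyadic_index j x)) => //.
    by exists (j, dyadic_index j x).
  move=> k; have [[w Ww <-]|/Cempty ->] := pselect (exists2 w, W w & pickle w = k).
    by apply: le_trans (Cdiam _ Ww) _; rewrite lee_fin small.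
  apply: ediam_le => [|x y []]; exact: ltW.
pose a k := gauge_cost (powgauge n) (C k).
have a0 k : (0 <= a k)%E by apply: gauge_cost_ge0; exact: powgauge_ge0.
rewrite -[leLHS]/(\sum_(0 <= k <oo) a k)%E nneseries_esumT//.
rewrite (_ : \esum_(k in [set: nat]) a k = \esum_(k in pickle @` W) a k)%E; last first.
  rewrite [RHS]esum_mkcond; apply: eq_esum => k _; case: ifPn => //.
  rewrite notin_setE => /= Wk; by rewrite /a Cempty ?gauge_cost0.
rewrite esum_image; last by move=> w w' _ _; exact: (pcan_inj pickleK_inv).
apply: (@le_trans _ _ (\esum_(w in W) ((s ^+ n)%:E * (dyadic_cost w.1)%:E))%E).
  apply: le_esum => w Ww; rewrite /a; have [->|/set0P C0] := eqVneq (C (pickle w)) set0.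
    by rewrite gauge_cost0 -EFinM lee_fin mulr_ge0 ?exprn_ge0 ?dyadic_cost_ge0// ltW.
  rewrite gauge_costE// -EFinM -exprMn.
  by apply: powgauge_le; [exact: ediam_ge0|exact: Cdiam].
apply: ge_ereal_sup => _ [X [fX XW] <-].
rewrite -ge0_mule_fsumr; last by move=> w; rewrite lee_fin dyadic_cost_ge0.
have : (\sum_(w \in X) (dyadic_cost w.1)%:E <= (e / s ^+ n)%:E)%E.
  apply: (@le_trans _ _ (net_cost dyadic_cost W)).
    by apply: ereal_sup_ubound; exists X.
  by apply: le_trans (ltW Weta) _; rewrite lee_fin ge_min lexx.
move=> /(lee_wpmul2l (x := (s ^+ n)%:E)) => /(_ _)/le_trans; apply.
  by rewrite lee_fin exprn_ge0// ltW.
by rewrite -EFinM lee_fin mulrC divfK// gt_eqF// exprn_gt0.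
Qed.

End dyadic.

(** * Small open neighborhoods of null sets *)

Section open_neighborhoods.
Variables (R : realType) (d n : nat).
Hypothesis n0 : (0 < n)%N.
Implicit Types (x y : 'rV[R]_d) (A : set 'rV[R]_d).

Lemma exists_expr2N_lt (e : R) : 0 < e -> exists m, 2 ^- m < e.
Proof.
move=> e0; exists (Num.trunc e^-1).+1.
rewrite -[ltRHS]invrK ltf_pV2 ?posrE ?invr_gt0 ?exprn_gt0//.
apply: lt_le_trans (truncnS_gt _) _.
by rewrite -natrX ler_nat; exact: ltnW (ltn_expl _ _).
Qed.

Lemma sum_half_pow_le (e : R) k : 0 <= e -> \sum_(j < k) e / 2 ^+ j.+1 <= e.
Proof.
move=> e0; suff -> : \sum_(j < k) e / 2 ^+ j.+1 = e * (1 - 2 ^- k).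
  by rewrite ler_piMr// gerBl invr_ge0 exprn_ge0.
elim: k => [|k IH]; first by rewrite big_ord0 expr0 invr1 subrr mulr0.
rewrite big_ord_recr /= IH -mulrDr; congr (_ * _).
by rewrite exprS invfM; lra.
Qed.

(** Take the least [m] with [2 ^- m.+1 <= t] or [(2 ^- m) ^+ n <= e]. Minimality gives [t < 2 ^- m];
    the second alternative is what stops the search when [t = 0]. *)
Lemma exists_dyadic_scale (t e : R) : 0 <= t -> t <= 2^-1 -> 0 < e ->
  exists m, t < 2 ^- m /\ (2 ^- m) ^+ n <= 2 ^+ n * t ^+ n + e.
Proof.
move=> t0 t1 e0; pose P m := (2 ^- m.+1 <= t) || ((2 ^- m) ^+ n <= e).
have exP : exists m, P m.
  have [m me] := exists_expr2N_lt e0; exists m; apply/orP; right.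
  apply: le_trans (ltW me); rewrite -[leRHS]expr1 ler_wiXn2l//.
  by rewrite invf_le1 ?exprn_gt0// exprn_ege1// ler1n.
case: (ex_minnP exP) => m Pm mmin; exists m; split.
  case: m => [|m] in Pm mmin *.
    by rewrite expr0 invr1; apply: le_lt_trans t1 _; lra.
  rewrite ltNge; apply/negP => mt.
  by have := mmin m; rewrite /P mt ltnn => /(_ isT).
case/orP: Pm => [mt|me]; last by rewrite ler_wpDl// mulr_ge0 ?exprn_ge0.
apply: (@le_trans _ _ (2 ^+ n * t ^+ n)); last by rewrite lerDl ltW.
rewrite -exprMn lerXn2r ?nnegrE ?mulr_ge0 ?invr_ge0 ?exprn_ge0//.
by move: mt; rewrite exprS invfM; lra.
Qed.

Lemma ball_coordP x y r : 0 < r ->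
  ball x r y <-> forall i, `|x ord0 i - y ord0 i| < r.
Proof.
move=> r0; split=> [[_ xy] i|xy]; first exact: xy.
by split=> // i j; rewrite (ord1 i); exact: xy.
Qed.

Lemma dyadic_content_ball m x : (dyadic_content n (ball x (2 ^- m)) <=
  (#|{ffun 'I_d -> 'I_3}|%:R * dyadic_cost R n m)%:E)%E.
Proof.
apply: (@le_trans _ _ (\sum_(s <- index_enum {ffun 'I_d -> 'I_3})
    dyadic_content n [set y | dyadic_index m y = dyadic_neighbor m x s])%E).
  apply: net_content_sum => [j|y xy]; first exact: dyadic_cost_ge0.
  have [|s sE] := @dyadic_neighborP R d m x y; last first.
    by exists s => //; exact: mem_index_enum.
  by apply/ball_coordP => //; rewrite invr_gt0 exprn_gt0.
apply: (@le_trans _ _ (\sum_(s : {ffun 'I_d -> 'I_3}) (dyadic_cost R n m)%:E)%E).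
  apply: lee_sum => s _; apply: net_content_cell.
  exact: dyadic_cost_ge0.
by rewrite sumEFin sumr_const mulr_natl.
Qed.

(** Each nonempty member of an efficient cover sits in an open ball of comparable dyadic radius, up
    to a summable error needed for members of diameter zero. This gives the other comparison of null
    sets, with open neighborhoods although dyadic cubes are not open. *)
Lemma hausdorff0_open_nbhd A (e : R) : hausdorff (@powgauge R n) A = 0%E ->
  0 < e -> exists U : set 'rV[R]_d,
    [/\ open U, A `<=` U & (dyadic_content n U <= e%:E)%E].
Proof.
move=> A0 e0; pose K : R := #|{ffun 'I_d -> 'I_3}|%:R.
have K0 : 0 < K.
  by rewrite ltr0n; apply/card_gt0P; exists [ffun=> ord0].
(* Chosen so that [K * (2 ^+ n * eta + eta) = e]: the diameters contribute the first term, the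
   errors the second. *)
pose eta := e / (K * (2 ^+ n + 1)).
have p0 : 0 < 2 ^+ n + 1 :> R by rewrite addr_gt0// exprn_gt0.
have eta0 : 0 < eta by rewrite divr_gt0// mulr_gt0.
have : (hcontent (@powgauge R n) 2^-1 A < eta%:E)%E.
  apply: le_lt_trans (hcontent_le_hausdorff _ _ _) _; first by rewrite invr_gt0.
  by rewrite A0 lte_fin.
move=> /ereal_inf_lt[_ [C [AC Cdiam] <-] Ceta].
pose a j := gauge_cost (@powgauge R n) (C j).
have a0 j : (0 <= a j)%E by apply: gauge_cost_ge0; exact: powgauge_ge0.
have asum k : (\sum_(j < k) a j <= eta%:E)%E.
  apply: le_trans (ltW Ceta); rewrite -(big_mkord xpredT a).
  exact: nneseries_lim_ge.
have afin j : a j \is a fin_num.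
  rewrite ge0_fin_numE//; apply: le_lt_trans (ltry eta).
  apply: le_trans (asum j.+1); rewrite big_ord_recr /= leeDr//.
  exact: sume_ge0.
pose u j := K * (2 ^+ n * fine (a j) + eta / 2 ^+ j.+1).
have /choice[G GP] : forall j, exists U : set 'rV[R]_d,
    [/\ open U, C j `<=` U & (dyadic_content n U <= (u j)%:E)%E].
  move=> j; have [->|/set0P Cj0] := eqVneq (C j) set0.
    exists set0; split; [exact: open0|by []|].
    apply: (@le_trans _ _ (@net_cost R _ (dyadic_cost R n) set0)).
      exact: net_content_le_cost.
    rewrite /net_cost esum_set0 lee_fin mulr_ge0 ?ltW//.
    by rewrite ltr_wpDl ?mulr_ge0 ?exprn_ge0 ?fine_ge0// divr_gt0// exprn_gt0.
  have [y Cy] := Cj0; pose t := fine (ediam (C j)).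
  have tE : ediam (C j) = t%:E.
    rewrite fineK// ge0_fin_numE ?ediam_ge0//.
    by apply: le_lt_trans (Cdiam j) _; rewrite ltry.
  have t0 : 0 <= t by rewrite -lee_fin -tE ediam_ge0.
  have t1 : t <= 2^-1 by rewrite -lee_fin -tE.
  have ej : 0 < eta / 2 ^+ j.+1 by rewrite divr_gt0// exprn_gt0.
  have [m [tm mP]] := exists_dyadic_scale t0 t1 ej.
  exists (ball y (2 ^- m)); split.
  - exact: ball_open.
  - move=> x Cx; apply/ball_coordP; first by rewrite invr_gt0 exprn_gt0.
    move=> i; apply: le_lt_trans (coord_le_edist _ _ _) _.
    by apply: le_lt_trans tm; rewrite -lee_fin -tE; exact: edist_le_ediam.
  - apply: le_trans (dyadic_content_ball _ _) _.
    rewrite lee_fin ler_pM2l//.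
    by rewrite /a gauge_costE// tE.
exists (\bigcup_j G j); split.
- by apply: bigcup_open => j _; have [] := GP j.
- by move=> x /AC[j _ Cx]; exists j => //; have [_ CO _] := GP j; exact: CO.
- apply: (net_content_sigma (@dyadic_cost_ge0 R n) (@dyadic_indexS R d) (e := u)).
    by move=> j; have [] := GP j.
  move=> k; rewrite -mulr_sumr big_split /= -mulr_sumr.
  have -> : e = K * (2 ^+ n * eta + eta).
    by rewrite -[X in _ + X]mul1r -mulrDl mulrA mulrC divfK// gt_eqF ?mulr_gt0.
  rewrite ler_pM2l// lerD//; last by rewrite sum_half_pow_le// ltW.
  rewrite ler_pM2l ?exprn_gt0// -lee_fin -sumEFin.
  by under eq_bigr do rewrite fineK//; exact: asum.
Qed.

End open_neighborhoods.

(** * Open hulls of null sets *)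

Section gauge_null_hull.
Variables (R : realType) (n : nat) (phi : \bar R -> \bar R).
Hypothesis gphi : gauge phi.
Implicit Types (A N : set 'rV[R]_n).

Let phi0 t : (0 <= t)%E -> (0 <= phi t)%E.
Proof. by case: gphi => phi0 _ _ _; exact: phi0. Qed.

(** Right continuity at [t] provides [s > t] with [phi s] still close to [phi t]; a thin enough
    uniform neighborhood of [A] has diameter at most [s]. *)
Lemma open_enlargement A (t e : R) : A !=set0 -> ediam A = t%:E ->
  phi t%:E \is a fin_num -> 0 < e ->
  exists U : set 'rV[R]_n, [/\ open U, A `<=` U, (ediam U <= (t + e)%:E)%E &
    (phi (ediam U) <= phi t%:E + e%:E)%E].
Proof.
move=> A0 At fint e0; have [_ phi_mono _ phi_right] := gphi.
have t0 : 0 <= t by rewrite -lee_fin -At ediam_ge0.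
have [s [ts st phis]] : exists s : R, [/\ t < s, s < t + e &
    (phi s%:E < phi t%:E + e%:E)%E].
  have near_s : \forall s \near t^'+, (phi s%:E < phi t%:E + e%:E)%E.
    apply: (phi_right t t0 [set y | (y < phi t%:E + e%:E)%E]).
    by apply: open_ereal_lt'; rewrite lteDl// lte_fin.
  have te : t < t + e by rewrite ltrDl.
  near t^'+ => s; exists s; split; near: s => //.
  - exact: nbhs_right_gt.
  - exact: nbhs_right_lt.
(* Each of the two endpoints may move by [(s - t) / 2]; the square root converts from the sup norm
   of the balls, and the summand 1 avoids a zero divisor. *)
pose r := (s - t) / 2 / (Num.sqrt n%:R + 1).
have sq0 : 0 < Num.sqrt n%:R + 1 :> R by rewrite ltr_wpDl ?sqrtr_ge0.
have r0 : 0 < r by rewrite !divr_gt0// subr_gt0.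
have rs : Num.sqrt n%:R * r <= (s - t) / 2.
  have : 0 <= (s - t) / 2 by rewrite divr_ge0// subr_ge0 ltW.
  rewrite /r; move: (_ / 2) => D D0; rewrite mulrCA ler_piMr//.
  by rewrite ler_pdivrMr// mul1r lerDl.
pose U : set 'rV[R]_n := \bigcup_(y in A) ball y r.
have dU : (ediam U <= s%:E)%E.
  apply: ediam_le => [|x x' [y Ay yx] [y' Ay' yx']]; first exact: le_trans (ltW ts).
  have near_dist (u v : 'rV[R]_n) : ball u r v -> Defs.edist u v <= (s - t) / 2.
    move=> uv; apply: le_trans rs; apply: edist_le => [|i]; first exact: ltW.
    by apply: ltW; move/ball_coordP: uv; exact.
  have h1 := near_dist _ _ (ball_sym yx); have h2 := near_dist _ _ yx'.
  have h3 : Defs.edist y y' <= t by rewrite -lee_fin -At edist_le_ediam.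
  have := edist_triangle x y x'; have := edist_triangle y y' x'.
  by lra.
exists U; split.
- by apply: bigcup_open => y _; exact: ball_open.
- by move=> x Ax; exists x => //; exact: ballxx.
- by apply: le_trans dU _; rewrite lee_fin ltW.
- by apply: le_trans (ltW phis); apply: phi_mono dU; exact: ediam_ge0.
Unshelve. all: by end_near. Qed.

Lemma null_open_hull N : hausdorff phi N = 0%E ->
  exists U : nat -> set 'rV[R]_n,
    [/\ forall k, open (U k), forall k, N `<=` U k &
        hausdorff phi (\bigcap_k U k) = 0%E].
Proof.
move=> N0.
(* In the factor 2, one half bounds the original cover and the other the loss in the enlargement. *)
have /choice[U UP] : forall k, exists U : set 'rV[R]_n, [/\ open U, N `<=` U &
    exists C : nat -> set 'rV[R]_n, [/\ U `<=` \bigcup_j C j,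
      forall j, (ediam (C j) <= (2 * 2 ^- k)%:E)%E &
      (cover_cost phi C <= (2 * 2 ^- k)%:E)%E]].
  move=> k; have ek0 : 0 < 2 ^- k :> R by rewrite invr_gt0 exprn_gt0.
  have : (hcontent phi (2 ^- k) N < (2 ^- k)%:E)%E.
    by apply: le_lt_trans (hcontent_le_hausdorff _ _ ek0) _; rewrite N0 lte_fin.
  move=> /ereal_inf_lt[_ [C [NC Cdiam] <-] Ce].
  have a0 j : (0 <= gauge_cost phi (C j))%E by exact: gauge_cost_ge0.
  have afin j : gauge_cost phi (C j) \is a fin_num.
    rewrite ge0_fin_numE//; apply: le_lt_trans (ltry (2 ^- k)).
    apply: le_trans (ltW Ce).
    apply: (@le_trans _ _ (\sum_(0 <= i < j.+1) gauge_cost phi (C i))%E).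
      by rewrite big_mkord big_ord_recr /= leeDr// sume_ge0.
    exact: nneseries_lim_ge.
  have /choice[V VP] : forall j, exists V : set 'rV[R]_n,
      [/\ open V, C j `<=` V, (ediam V <= (2 * 2 ^- k)%:E)%E &
      (gauge_cost phi V <= gauge_cost phi (C j) + (2 ^- k / (2 ^ j.+1)%:R)%:E)%E].
    move=> j; have ej0 : 0 < 2 ^- k / (2 ^ j.+1)%:R :> R.
      by rewrite divr_gt0// ltr0n expn_gt0.
    have [->|/set0P Cj0] := eqVneq (C j) set0.
      exists set0; split; [exact: open0|by []| |].
        by apply: ediam_le => //; rewrite mulr_ge0// ltW.
      by rewrite leeDl// lee_fin ltW.
    pose t := fine (ediam (C j)).
    have tE : ediam (C j) = t%:E.
      rewrite fineK// ge0_fin_numE ?ediam_ge0//.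
      by apply: le_lt_trans (Cdiam j) _; rewrite ltry.
    have fint : phi t%:E \is a fin_num by rewrite -tE -gauge_costE.
    have [V [oV CV dV pV]] := open_enlargement Cj0 tE fint ej0.
    exists V; split => //.
      apply: le_trans dV _; rewrite lee_fin mulr_natl mulr2n lerD//.
        by rewrite -lee_fin -tE.
      rewrite ler_piMr ?ltW// invf_lt1 ?ltr0n ?expn_gt0// ltr1n.
      by rewrite -{1}(expn0 2) ltn_exp2l.
    have V0 : V !=set0 by have [y Cy] := Cj0; exists y; exact: CV.
    by rewrite !gauge_costE// tE.
  exists (\bigcup_j V j); split.
  - by apply: bigcup_open => j _; have [] := VP j.
  - by move=> x /NC[j _ Cx]; exists j => //; have [_ CV _ _] := VP j; exact: CV.
  - exists V; split => // [j|]; first by have [] := VP j.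
    apply: (@le_trans _ _ (\sum_(0 <= j <oo)
        (gauge_cost phi (C j) + (2 ^- k / (2 ^ j.+1)%:R)%:E))%E).
      apply: lee_nneseries => [j _ _|j _]; first exact: gauge_cost_ge0.
      by have [] := VP j.
    apply: le_trans (epsilon_trick _ a0 (ltW ek0)) _.
    rewrite mulr_natl mulr2n EFinD leeD2r//; exact: ltW.
exists U; split=> [k|k|]; [by have [] := UP k|by have [] := UP k|].
apply/eqP; rewrite eq_le hausdorff_ge0// andbT.
apply: ge_ereal_sup => _ [delta /= delta0 <-]; apply/lee_addgt0Pr => e e0.
rewrite add0e.
have [|k] := @exists_expr2N_lt R (Num.min delta e / 2).
  by rewrite divr_gt0// lt_min delta0.
rewrite ltr_pdivlMr// mulrC lt_min => /andP[kdelta ke].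
have [_ _ [C [UC Cdiam Ccost]]] := UP k.
apply: (@le_trans _ _ (cover_cost phi C)).
  apply: ereal_inf_lbound; exists C => //; split; first by move=> x /(_ k I)/UC.
  by move=> j; apply: le_trans (Cdiam j) _; rewrite lee_fin ltW.
by apply: le_trans Ccost _; rewrite lee_fin ltW.
Qed.

End gauge_null_hull.

(** * The compact set *)

Section flats.
Variables (R : realType) (n : nat).
Implicit Types (a x : 'rV[R]_n) (S : {set 'I_n}).

Definition coord_flat S a : set 'rV[R]_n :=
  [set x | forall i, i \in S -> x ord0 i = a ord0 i].

Lemma closed_coord_eq i (r : R) : closed [set x : 'rV[R]_n | x ord0 i = r].
Proof.
apply: (@preimage_closed _ _ (fun x : 'rV[R]_n => x ord0 i) [set r]).
  by move=> x _; exact: coord_continuous.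
exact: closed_eq.
Qed.

Lemma closed_coord_flat S a : closed (coord_flat S a).
Proof.
rewrite (_ : coord_flat S a = \bigcap_(i in [set i | i \in S])
  [set x : 'rV[R]_n | x ord0 i = a ord0 i]).
  by apply: closed_bigI => i _; exact: closed_coord_eq.
by apply/seteqP; split => x.
Qed.

(* The flat is one of least dimension on which N stays outside the ideal. *)
Lemma exists_irreducible_flat (I : set 'rV[R]_n -> Prop) (N : set 'rV[R]_n) :
  (forall A B, A `<=` B -> I B -> I A) -> ~ I N ->
  exists S a, ~ I (N `&` coord_flat S a) /\
    forall i (r : R), i \notin S ->
      I (N `&` coord_flat S a `&` [set x | x ord0 i = r]).
Proof.
move=> Imono NI.
pose P (S : {set 'I_n}) := `[< exists a, ~ I (N `&` coord_flat S a) >].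
have P0 : P finset.set0.
  apply/asboolP; exists 0; apply: contra_not NI; apply: Imono => x Nx.
  by split=> // i; rewrite inE.
case: (@arg_maxnP _ finset.set0 P (fun S => #|S|) P0) => S /asboolP[a NS] Smax.
exists S, a; split=> // i r iS; apply: contrapT => nI.
have : P (i |: S)%SET.
  apply/asboolP; exists (\row_j if j == i then r else a ord0 j).
  apply: contra_not nI; apply: Imono => x [[Nx Vx] /= xi]; split=> // j.
  rewrite !inE mxE; case: eqP => [->//|_] /= jS; exact: Vx.
by move=> /Smax; rewrite cardsU1 iS /= add1n ltnn.
Qed.

(** Two distinct points of a connected part of [K] differ in a coordinate outside [S]; the
    projection to it is an interval and contains a rational number. *)
Lemma totally_disconnected_flat S a (K : set 'rV[R]_n) : K `<=` coord_flat S a ->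
  (forall i (r : rat) x, i \notin S -> K x -> x ord0 i <> ratr r) ->
  totally_disconnected K.
Proof.
move=> KV Krat x Kx; apply/seteqP; split => [y [C [Cx CK Cconn] Cy]|y ->]; last first.
  exact: connected_component_refl.
apply: contrapT => yx; have [i xyi] : exists i, x ord0 i != y ord0 i.
  apply: contrapT => /forallNP h; apply: yx; apply/rowP => i.
  by have /negP := h i; rewrite negbK => /eqP.
have iS : i \notin S.
  by apply: contra xyi => iS; rewrite (KV _ (CK _ Cx))// (KV _ (CK _ Cy)).
have /connected_intervalP Citv : connected ((fun z : 'rV[R]_n => z ord0 i) @` C).
  apply: connected_continuous_connected => //.
  by apply: continuous_subspaceT => z; exact: coord_continuous.
wlog xy : x y {yx xyi Kx} Cx Cy / x ord0 i < y ord0 i => [wl|].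
  move: xyi; rewrite neq_lt => /orP[xy|yx']; first exact: (wl x y).
  exact: (wl y x).
have [r /[!in_itv] /andP[xr ry]] := rat_in_itvoo xy.
have [z Cz zr] : ((fun z : 'rV[R]_n => z ord0 i) @` C) (ratr r).
  apply: (Citv (x ord0 i) (y ord0 i)); [by exists x|by exists y|].
  by rewrite !ltW.
exact: (Krat i r z iS (CK _ Cz)).
Qed.

End flats.

(** * Compact exhaustion of open sets *)

Section compact_exhaustion.
Variables (R : realType) (n : nat).
Implicit Types (O : set 'rV[R]_n).

(** Quantifying over the points outside [O] replaces the distance to the complement, which may be
    empty. *)
Definition compact_exhaustion O (i : nat) : set 'rV[R]_n :=
  [set x | `|x| <= i%:R /\ forall y, ~ O y -> i.+1%:R^-1 <= `|x - y|].

Lemma compact_compact_exhaustion O i : compact (compact_exhaustion O i).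
Proof.
apply: bounded_closed_compact.
  exists i%:R; split; first exact: realn.
  by move=> M iM x [xi _]; apply: le_trans xi (ltW iM).
rewrite (_ : compact_exhaustion O i = [set x | `|x| <= i%:R] `&`
    \bigcap_(y in ~` O) [set x | i.+1%:R^-1 <= `|x - y|]); last first.
  by apply/seteqP; split => x [? ?].
apply: closedI.
  apply: (@preimage_closed _ _ (fun x : 'rV[R]_n => `|x|) [set r | r <= i%:R]).
    by move=> x _; exact: norm_continuous.
  exact: closed_le.
apply: closed_bigI => y _.
rewrite (_ : mkset _ = ~` ball y i.+1%:R^-1).
  exact/open_closedC/ball_open.
by apply/seteqP; split=> x; rewrite -ball_normE /= distrC leNgt => /negP.
Qed.

Lemma compact_exhaustionS O i j : (i <= j)%N ->
  compact_exhaustion O i `<=` compact_exhaustion O j.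
Proof.
move=> ij x [xi xO]; split; first by apply: le_trans xi _; rewrite ler_nat.
by move=> y /xO; apply: le_trans; rewrite lef_pV2 ?posrE// ler_nat ltnS.
Qed.

Lemma compact_exhaustion_sub O i : compact_exhaustion O i `<=` O.
Proof.
move=> x [_ xO]; apply: contrapT => /xO.
by rewrite subrr normr0 leNgt invr_gt0 ltr0n.
Qed.

Lemma compact_exhaustion_cover O x : open O -> O x ->
  exists i, compact_exhaustion O i x.
Proof.
move=> oO Ox; have /nbhs_ballP[e /= e0 xeO] : nbhs x O by exact: open_nbhs_nbhs.
pose i := maxn (Num.trunc `|x|).+1 (Num.trunc e^-1).+1.
exists i; split.
  by apply: le_trans (ltW (truncnS_gt _)) _; rewrite ler_nat leq_maxl.
move=> y Oy; rewrite leNgt; apply/negP => xy; apply: Oy; apply: xeO.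
rewrite -ball_normE /=; apply: lt_trans xy _.
rewrite -[ltRHS]invrK ltf_pV2 ?posrE ?invr_gt0//.
apply: lt_le_trans (truncnS_gt _) _.
by rewrite ler_nat; apply: leqW; exact: leq_maxr.
Qed.

End compact_exhaustion.

(** The open sets formed by [W] and the complement of [C k] cover the compact set [C 0]; a finite
    subcover gives [m]. *)
Lemma compact_bigcap_sub (T : ptopologicalType) (C : nat -> set T) (W : set T) :
  compact (C 0%N) -> (forall k, closed (C k)) -> open W ->
  \bigcap_k C k `<=` W -> exists m, \bigcap_(k in `I_m.+1) C k `<=` W.
Proof.
move=> C0 Cclosed oW CW; move: C0; rewrite compact_cover.
move=> /(_ nat setT (fun k => W `|` ~` C k))[||D _ DC].
- by move=> k _; apply: openU => //; exact: closed_openC.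
- move=> x _; have [Wx|nWx] := pselect (W x); first by exists 0%N => //; left.
  have [k nCk] : exists k, ~ C k x.
    by apply: contrapT => /forallNP h; apply/nWx/CW => k _; exact: contrapT.
  by exists k => //; right.
have /finite_seqP[s Ds] := finite_fset D; rewrite Ds in DC.
exists (\max_(k <- s) k)%N => x Cx.
have [k /= ks [//|]] := DC x (Cx 0%N isT); case; apply: Cx => /=.
by rewrite ltnS; apply: leq_bigmax_seq.
Qed.

(** * Perfect kernel relative to a sigma-ideal *)

Section perfect_kernel.
Variables (R : realType) (n : nat) (I : set 'rV[R]_n -> Prop).
Hypothesis I_sub : forall A B, A `<=` B -> I B -> I A.
Hypothesis I_bigcup : forall A : nat -> set 'rV[R]_n,
  (forall k, I (A k)) -> I (\bigcup_k A k).
Hypothesis I_set1 : forall x, I [set x].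

Lemma idealU A B : I A -> I B -> I (A `|` B).
Proof.
move=> IA IB; apply: (@I_sub _ (\bigcup_k if k is 0%N then A else B)).
  by move=> x [Ax|Bx]; [exists 0%N|exists 1%N].
by apply: I_bigcup => -[].
Qed.

(** For the ideal of countable sets these are the condensation points of [K] in [K], as in the
    Cantor-Bendixson theorem. *)
Definition perfect_kernel (K : set 'rV[R]_n) : set 'rV[R]_n :=
  [set x | K x /\ forall B, nbhs x B -> ~ I (K `&` B)].

(** Every point removed lies in a dyadic cell whose trace on [K] is in the ideal, and there are only
    countably many cells. *)
Lemma perfect_kernel_diff K : I (K `\` perfect_kernel K).
Proof.
pose cell (w : nat * {ffun 'I_n -> int}) : set 'rV[R]_n :=
  K `&` [set x | dyadic_index w.1 x = w.2].
pose A k := \bigcup_(w in [set w | pickle w = k /\ I (cell w)]) cell w.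
apply: (@I_sub _ (\bigcup_k A k)); last first.
  apply: I_bigcup => k.
  have [[w [wk Iw]]|nw] := pselect (exists w, pickle w = k /\ I (cell w)).
    apply: I_sub Iw => x [w' [w'k _]].
    by rewrite (pcan_inj pickleK_inv (etrans w'k (esym wk))).
  by apply: (@I_sub _ [set 0]) => // x [w wk _]; case: nw; exists w.
move=> x [Kx nKx]; have [B [xB IB]] : exists B, nbhs x B /\ I (K `&` B).
  apply: contrapT => /forallNP h; apply: nKx; split=> // B xB IB.
  by apply: (h B).
have /nbhs_ballP[e /= e0 xeB] := xB.
have [m me] := exists_expr2N_lt e0.
exists (pickle (m, dyadic_index m x)) => //.
exists (m, dyadic_index m x) => //; split=> //.
apply: I_sub IB => y [Ky /= yx]; split=> //; apply: xeB.
apply/ball_coordP => // i; apply: le_lt_trans me.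
exact: dyadic_index_dist.
Qed.

Lemma perfect_kernelN K : ~ I K -> ~ I (perfect_kernel K).
Proof.
apply: contra_not => IK; apply: I_sub (idealU IK (perfect_kernel_diff K)) => x Kx.
by have [?|?] := pselect (perfect_kernel K x); [left|right].
Qed.

Lemma closed_perfect_kernel K : closed K -> closed (perfect_kernel K).
Proof.
move=> cK x clx; split.
  by apply: cK => B xB; have [y [[Ky _] By]] := clx B xB; exists y.
move=> B xB; have [y [[_ yB] By]] := clx _ (nbhs_interior xB).
exact: yB.
Qed.

(** Near an isolated point [x] of the kernel, [K] would consist of [x] and points outside the
    kernel, so its trace would be in the ideal. *)
Lemma perfect_perfect_kernel K : closed K -> perfect_set (perfect_kernel K).
Proof.
move=> cK; split; first exact: closed_perfect_kernel.
apply/seteqP; split=> x.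
  move=> lx; apply: (closed_perfect_kernel cK) => B /lx[y [_ Ky By]].
  by exists y.
move=> [Kx xK] B xB; apply: contrapT => nB; apply: (xK B xB).
apply: I_sub (idealU (I_set1 x) (perfect_kernel_diff K)) => y [Ky By].
have [->|yx] := eqVneq y x; first by left.
by right; split=> // Ky'; apply: nB; exists y.
Qed.

End perfect_kernel.

(** * Compact sets with non-null image *)

Section compact_subset.
Variables (R : realType) (n d : nat) (Omega : set 'rV[R]_n).
Variable f : 'rV[R]_n -> 'rV[R]_d.
Hypotheses (n0 : (0 < n)%N) (oOmega : open Omega).
Hypothesis fcont : {within Omega, continuous f}.

(* Since the content is continuous along increasing sets, N can be cut down to
   N `&` F 0 `&` ... `&` F k, with F k compact in O k, keeping the content of its
   image above c; the intersection K of the F k then has an image of positive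
   measure, for otherwise this image would have an open neighborhood of content
   at most c containing the image of F 0 `&` ... `&` F k for large k. *)
Lemma exists_compact_image_pos (N V : set 'rV[R]_n) (O : nat -> set 'rV[R]_n)
    (c : R) :
  closed V -> N `<=` V -> (forall k, open (O k)) -> (forall k, N `<=` O k) ->
  O 0%N `<=` Omega -> 0 < c -> (c%:E < dyadic_content n (f @` N))%E ->
  exists K, [/\ compact K, K `<=` V, forall k, K `<=` O k &
    hausdorff (@powgauge R n) (f @` K) <> 0%E].
Proof.
move=> cV NV oO NO OOmega c0 cN.
(* If every [i] failed, continuity along the increasing exhaustion would bound the content of the
   whole image by [c]. Making [g] a function of the pair lets the sets be defined by recursion. *)
have /choice[g gP] : forall Ek : set 'rV[R]_n * nat, exists i,
    Ek.1 `<=` O Ek.2 -> (c%:E < dyadic_content n (f @` Ek.1))%E ->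
    (c%:E < dyadic_content n
      (f @` (Ek.1 `&` compact_exhaustion (O Ek.2) i)))%E.
  move=> [E k] /=; apply: contrapT => /forallNP h.
  have [EO cE] : E `<=` O k /\ (c%:E < dyadic_content n (f @` E))%E.
    split=> [x Ex|]; first by apply: contrapT => nx; apply: (h 0%N) => /(_ x Ex).
    by rewrite ltNge; apply/negP => Ec; apply: (h 0%N) => _; rewrite ltNge Ec.
  move: cE; rewrite ltNge => /negP; apply.
  rewrite (_ : f @` E = \bigcup_i (f @` (E `&` compact_exhaustion (O k) i))).
    apply: (net_content_bigcup (@dyadic_cost_ge0 R n) (@dyadic_indexS R d)).
      move=> i j ij; apply: image_subset => x [Ex xi]; split=> //.
      exact: compact_exhaustionS xi.
    move=> i; rewrite leNgt; apply/negP => ci; exact: (h i).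
  apply/seteqP; split=> y [].
    move=> x Ex <-; have [i xi] := compact_exhaustion_cover (oO k) (EO _ Ex).
    by exists i => //; exists x.
  by move=> i _ [x [Ex _] <-]; exists x.
pose E := fix E k := if k is k'.+1 then
  E k' `&` compact_exhaustion (O k') (g (E k', k')) else N.
pose F k := compact_exhaustion (O k) (g (E k, k)).
have EN k : E k `<=` N by elim: k => // k IH x [/IH].
have EO k : E k `<=` O k by move=> x /EN/NO.
have Ec k : (c%:E < dyadic_content n (f @` E k))%E.
  by elim: k => // k IH; exact: (gP (E k, k) (EO k) IH).
have EF k j : (j < k)%N -> E k `<=` F j.
  elim: k => // k IH; rewrite ltnS leq_eqVlt => /predU1P[-> x []//|jk x [Ekx _]].
  exact: IH Ekx.
have Fclosed k : closed (F k).
  by apply: compact_closed; [exact: norm_hausdorff|exact: compact_compact_exhaustion].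
pose C k := V `&` F k; have Cclosed k : closed (C k) by exact: closedI.
have C0 : compact (C 0%N).
  apply: (subclosed_compact (Cclosed 0%N) (@compact_compact_exhaustion _ _ _ _)).
  exact: subIsetr.
pose K := \bigcap_k C k; have KO k : K `<=` O k.
  by move=> x /(_ k Logic.I)[_ /compact_exhaustion_sub].
exists K; split=> //.
- apply: subclosed_compact C0 _; first exact: closed_bigI.
  by move=> x; exact.
- by move=> x /(_ 0%N Logic.I)[].
move=> fK0; have [U [oU KU Uc]] := hausdorff0_open_nbhd n0 fK0 c0.
(* The preimage of [U] is only relatively open in [Omega]; the intersection is open because [Omega]
   is. *)
have oW : open (Omega `&` f @^-1` U).
  move: fcont; rewrite continuous_open_subspace//.
  by move=> /(continuous_inP _ oOmega); exact.
have [|m mW] := compact_bigcap_sub C0 Cclosed oW.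
  by move=> x Kx; split; [apply/OOmega/KO|apply: KU; exists x].
have := Ec m.+1; rewrite ltNge => /negP; apply; apply: le_trans Uc.
apply: net_contentS => _ [x Ex <-]; apply: (mW x _).2 => k /= km.
by split; [exact/NV/EN/Ex|exact: EF Ex].
Qed.

(** For positive [n] this means that the image has zero n-dimensional Hausdorff measure; the content
    gives the sigma-ideal properties directly. *)
Definition image_null (A : set 'rV[R]_n) : Prop :=
  dyadic_content n (f @` A) = 0%E.

Lemma image_nullS A B : A `<=` B -> image_null B -> image_null A.
Proof.
rewrite /image_null => AB B0; apply/eqP.
rewrite eq_le -{1}B0 net_contentS ?net_content_ge0//; last exact: image_subset.
exact: dyadic_cost_ge0.
Qed.

Lemma image_null_bigcup (A : nat -> set 'rV[R]_n) :
  (forall k, image_null (A k)) -> image_null (\bigcup_k A k).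
Proof.
move=> A0; apply/eqP; rewrite eq_le net_content_ge0 ?andbT; last first.
  exact: dyadic_cost_ge0.
rewrite image_bigcup.
apply: (net_content_sigma (@dyadic_cost_ge0 R n) (@dyadic_indexS R d)
  (e := fun=> 0)) => [k|k].
  by have := A0 k; rewrite /image_null /dyadic_content => ->.
by rewrite big1.
Qed.

Lemma image_null_set1 x : image_null [set x].
Proof.
apply/eqP; rewrite eq_le net_content_ge0 ?andbT; last exact: dyadic_cost_ge0.
apply/lee_addgt0Pr => e e0; rewrite add0e.
have [|m [_ me]] := @exists_dyadic_scale R n n0 0 e (lexx _) _ e0.
  by rewrite invr_ge0.
rewrite image_set1.
apply: (@le_trans _ _ (dyadic_content n
  [set y | dyadic_index m y = dyadic_index m (f x)])).
  by apply: net_contentS => y ->.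
apply: le_trans (net_content_cell _ _ _ _) _; first exact: dyadic_cost_ge0.
by rewrite lee_fin; apply: le_trans me _; rewrite expr0n gtn_eqF//= mulr0 add0r.
Qed.

End compact_subset.

Theorem theorem6p1 (R : realType) (n d : nat) (Omega : set 'rV[R]_n)
    (f : 'rV[R]_n -> 'rV[R]_d) (phi : \bar R -> \bar R) :
  (2 <= n)%N -> (1 <= d)%N -> open Omega -> {within Omega, continuous f} ->
  gauge phi ->
  (exists N : set 'rV[R]_n, N `<=` Omega /\ hausdorff phi N = 0%E /\
     (0 < hausdorff (@powgauge R n) (f @` N))%E) ->
  exists K : set 'rV[R]_n, [/\ K `<=` Omega, cantor_set K,
     hausdorff phi K = 0%E & (0 < hausdorff (@powgauge R n) (f @` K))%E].
Proof.
move=> n2 _ oOmega fcont gphi [N [NOmega [N0 fN]]].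
have n0 : (0 < n)%N by exact: ltnW.
pose null := image_null f.
have nullS := @image_nullS R n d f.
have null_bigcup := @image_null_bigcup R n d f.
have null_set1 := @image_null_set1 R n d f n0.
have phi0 : forall t, (0 <= t)%E -> (0 <= phi t)%E by case: gphi.
have Nnull : ~ null N.
  by move=> /(hausdorff0_dyadic_content0 n0) fN0; rewrite fN0 ltxx in fN.
have [U [oU NU U0]] := null_open_hull gphi N0.
have [S [a [N1null Nslice]]] := exists_irreducible_flat nullS Nnull.
pose N1 := N `&` coord_flat S a.
(* The complement of the rational hyperplane with code [k] in a direction outside [S], or the whole
   space if [k] codes none. Coding keeps the family countable. *)
pose H k : set 'rV[R]_n := [set x | forall w : 'I_n * rat,
  pickle w = k -> w.1 \notin S -> x ord0 w.1 <> ratr w.2].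
have HP k : H k = setT \/ exists w : 'I_n * rat,
    w.1 \notin S /\ H k = [set x | x ord0 w.1 <> ratr w.2].
  have [[w [wk wS]]|nw] := pselect (exists w : 'I_n * rat,
    pickle w = k /\ w.1 \notin S).
    right; exists w; split=> //; apply/seteqP; split=> x; first exact.
    by move=> xw w' w'k _; rewrite (pcan_inj pickleK_inv (etrans w'k (esym wk))).
  by left; apply/seteqP; split=> // x _ w wk wS; case: nw; exists w.
have oH k : open (H k).
  case: (HP k) => [->|[w [_ ->]]]; first exact: openT.
  exact/closed_openC/closed_coord_eq.
pose N2 := N1 `&` \bigcap_k H k.
have N2null : ~ null N2.
  apply: contra_not N1null => N2null.
  have N1H : null (\bigcup_k (N1 `\` H k)).
    apply: null_bigcup => k; case: (HP k) => [->|[w [wS ->]]].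
      by apply: nullS (null_set1 0) => x [_]; case.
    apply: nullS (Nslice w.1 (ratr w.2) wS) => x [N1x xw]; split=> //=.
    exact: contrapT.
  apply: nullS (idealU nullS null_bigcup N2null N1H) => x N1x.
  have [Hx|nHx] := pselect ((\bigcap_k H k) x); first by left.
  right; apply: contrapT => h; apply: nHx => k _; apply: contrapT => nHk.
  by apply: h; exists k.
(* Half the content serves if it is finite, and 1 if it is infinite. *)
have [c c0 cN2] : exists2 c, 0 < c & (c%:E < dyadic_content n (f @` N2))%E.
  have : dyadic_content n (f @` N2) <> 0%E := N2null.
  have := @net_content_ge0 R _ _ (@dyadic_index R d) _ (@dyadic_cost_ge0 R n) (f @` N2).
  rewrite /dyadic_content; case: (net_content _ _ _) => [r| |]//=.
    rewrite lee_fin le_eqVlt => /predU1P[<-//|r0 _].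
    by exists (r / 2); rewrite ?lte_fin ?divr_gt0//; lra.
  by exists 1; rewrite ?ltry.
(* One sequence of open sets carries the gauge-null hull, the domain and the avoidance of the
   rational hyperplanes. *)
pose O k := U k `&` Omega `&` H k.
have [|||||||K [cK KV KO fK]] := @exists_compact_image_pos R n d Omega f n0 oOmega
  fcont N2 (coord_flat S a) O c.
- exact: closed_coord_flat.
- by move=> x [[]].
- by move=> k; apply: openI => //; exact: openI.
- by move=> k x [[Nx _] Hx]; split; [split; [exact: NU|exact: NOmega]|exact: Hx].
- by move=> x [[]].
- exact: c0.
- exact: cN2.
have Kclosed : closed K by apply: compact_closed => //; exact: norm_hausdorff.
have Knull : ~ null K by move=> /(hausdorff0_dyadic_content0 n0).
pose P := perfect_kernel null K; have PK : P `<=` K by move=> x [].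
have Pnull : ~ null P by exact: perfect_kernelN.
have perfP : perfect_set P by exact: perfect_perfect_kernel.
exists P; split.
- by move=> x /PK/(KO 0%N)[[]].
- split.
  + apply: contrapT => /nonemptyPn P0; apply: Pnull; rewrite P0.
    by apply: nullS (null_set1 0).
  + by apply: subclosed_compact cK PK; case: perfP.
  + exact: perfP.
  + apply: (@totally_disconnected_flat R n S a) => [x /PK/KV//|i r x iS /PK Kx].
    have [_ Hx] := KO (pickle (i, r)) x Kx.
    exact: (Hx (i, r)).
- apply/eqP; rewrite eq_le hausdorff_ge0// andbT -U0; apply: hausdorffS.
  by move=> x /PK Kx k _; have [[]] := KO k x Kx.
(* If the image had measure zero, its open neighborhoods of arbitrarily small content would make [P]
   null. *)
- rewrite lt_neqAle hausdorff_ge0 ?andbT; last exact: powgauge_ge0.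
  apply/eqP => /esym fP0; apply: Pnull; apply/eqP.
  rewrite eq_le net_content_ge0 ?andbT; last exact: dyadic_cost_ge0.
  apply/lee_addgt0Pr => e e0; rewrite add0e.
  have [W [_ PW We]] := hausdorff0_open_nbhd n0 fP0 e0.
  by apply: le_trans We; exact: net_contentS.
Qed.
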